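(* Let $q\in\mathbb{C}\setminus\{0\}$ and $N\ge 1$. Then $V'(N)$ is a module for the Lie algebra $\widehat{\mathcal{G}'}$ under the action $\pi$ given (linearly) by $$\pi(\tilde g_{ij}(m,n))=G_{ij}(m,n),\quad \pi(\tilde f_{ij}(m,n))=F_{ij}(m,n),\quad \pi(\tilde h_{ij}(m,n))=H_{ij}(m,n),$$ $$\pi(\tilde e_i(m,n))=E_i(m,n),\quad \pi(\tilde e_i^*(m,n))=E_i^*(m,n),\quad \pi(\tilde e_0(m,n))=E_0(m,n),$$ $$\pi(c(n))=\frac12\,\mathrm{id}\ \ (n\in\Lambda(q)),\qquad \pi(c_y)=0,$$ where in the first two lines $m,n\in\mathbb{Z}$ and $1\le i,j\le N$, and elements of $\mathcal{G}'$ are written as linear combinations of the $\tilde f_{ij},\tilde g_{ij},\tilde h_{ij},\tilde e_i,\tilde e_i^*,\tilde e_0$.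
   Context: Quantum torus: $\mathbb{C}_q$ is the unital associative $\mathbb{C}$-algebra with generators $x^{\pm1},y^{\pm1}$ and relations $xx^{-1}=x^{-1}x=yy^{-1}=y^{-1}y=1$, $yx=qxy$; it has basis $\{x^my^n\}_{m,n\in\mathbb{Z}}$. $\Lambda(q)=\{n\in\mathbb{Z}: q^n=1\}$. The bar is the anti-involution ($\mathbb{C}$-linear) of $\mathbb{C}_q$ with $\bar x=x$, $\bar y=y^{-1}$. Lie algebra $\widehat{gl_r(\mathbb{C}_q)}$: as a vector space it is $gl_r(\mathbb{C}_q)\oplus\bigl(\bigoplus_{n\in\Lambda(q)}\mathbb{C}c(n)\bigr)\oplus\mathbb{C}c_y$, with all $c(n)$ and $c_y$ central and, writing $e_{ij}(a)=a e_{ij}$, $$[e_{ij}(x^my^n),e_{kl}(x^py^s)]=\delta_{jk}q^{np}e_{il}(x^{m+p}y^{n+s})-\delta_{il}q^{ms}e_{kj}(x^{m+p}y^{n+s})+mq^{np}\delta_{jk}\delta_{il}\delta_{m+p,0}\delta_{\overline{n+s},\overline 0}\,c(n+s)+nq^{np}\delta_{jk}\delta_{il}\delta_{m+p,0}\delta_{n+s,0}\,c_y,$$ where $\bar t$ denotes the class of $t$ in $\mathbb{Z}/\Lambda(q)$ (so the $c(n+s)$ term is present only if $n+s\in\Lambda(q)$). Lie algebra $\mathcal{G}'$: matrices in $M_{2N+1}(\mathbb{C}_q)$ have rows and columns indexed by $0,1,\dots,2N$. Let $G=\begin{pmatrix}1&0&0\\0&0&I_N\\0&I_N&0\end{pmatrix}$,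 $A^*=G^{-1}\bar A^tG$ (bar entrywise), $S=\{A\in M_{2N+1}(\mathbb{C}_q):A^*=-A\}$, and $\mathcal{G}'=[S,S]$ (commutator bracket). $S$ is spanned by the elements ($m,n\in\mathbb{Z}$, $1\le i,j\le N$) $$\tilde f_{ij}(m,n)=x^my^ne_{ij}-\overline{x^my^n}e_{N+j,N+i},\quad \tilde g_{ij}(m,n)=x^my^ne_{i,N+j}-\overline{x^my^n}e_{j,N+i},\quad \tilde h_{ij}(m,n)=x^my^ne_{N+i,j}-\overline{x^my^n}e_{N+j,i},$$ $$\tilde e_i(m,n)=x^my^ne_{i,0}-\overline{x^my^n}e_{0,N+i},\quad \tilde e_i^*(m,n)=x^my^ne_{N+i,0}-\overline{x^my^n}e_{0,i},\quad \tilde e_0(m,n)=(x^my^n-\overline{x^my^n})e_{0,0}.$$ $\widehat{\mathcal{G}'}=\mathcal{G}'\oplus\bigl(\bigoplus_{n\in\Lambda(q)}\mathbb{C}c(n)\bigr)\oplus\mathbb{C}c_y$ with the bracket restricted from $\widehat{gl_{2N+1}(\mathbb{C}_q)}$. The module: put $\{a,b\}_+=ab+ba$. $\alpha'(N)$ is the unital associative algebra generated by $a_i(m),a_i^*(m),e(m)$ ($1\le i\le N$, $m\in\mathbb{Z}$) with relations $\{a_i(m),a_j(n)\}_+=\{a_i^*(m),a_j^*(n)\}_+=0$, $\{a_i(m),a_j^*(n)\}_+=\delta_{ij}\delta_{m+n,0}$, $\{e(m),e(n)\}_+=\delta_{m+n,0}$, $\{a_i(m),e(n)\}_+=\{a_i^*(m),e(n)\}_+=0$.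 $V'(N)=\alpha'(N)v_0'$ is a simple $\alpha'(N)$-module generated by a (nonzero) vacuum vector $v_0'$ killed by $a_i(n),a_i^*(n),e(n)$ ($n>0$) and by $a_i^*(0)$, $1\le i\le N$, and on which $e(0)$ acts as a scalar. (Equivalently $V'(N)=V(N,+)\otimes V_0$ with $V(N,+)$ and $V_0$ the simple vacuum modules of the algebras generated by the $a_i(m),a_i^*(m)$ and by the $e(m)$ respectively, with signs making the $e(n)$ anticommute with the $a_i(m),a_i^*(m)$.) Normal ordering, for $u,v\in\{a_i,a_i^*,e\}$: $:u(m)v(n):\,=u(m)v(n)$ if $n>m$; $=\frac12(u(m)v(n)-v(n)u(m))$ if $m=n$; $=-v(n)u(m)$ if $m>n$. Operators on $V'(N)$ (only finitely many summands are nonzero on any given vector): $$f_{ij}(m,n)=\sum_{s\in\mathbb{Z}}q^{-ns}:a_i(m-s)a_j^*(s):,\quad g_{ij}(m,n)=\sum_{s\in\mathbb{Z}}q^{-ns}:a_i(m-s)a_j(s):,\quad h_{ij}(m,n)=\sum_{s\in\mathbb{Z}}q^{-ns}:a_i^*(m-s)a_j^*(s):,$$ $$e_i(m,n)=\sum_{s\in\mathbb{Z}}q^{-ns}:a_i(m-s)e(s):,\quad e_i^*(m,n)=\sum_{s\in\mathbb{Z}}q^{-ns}:a_i^*(m-s)e(s):,\quad e_0(m,n)=\sum_{s\in\mathbb{Z}}q^{-ns}:e(m-s)e(s):.$$ Set $G_{ij}(m,n)=g_{ij}(m,n)$, $H_{ij}(m,n)=h_{ij}(m,n)$, $E_i(m,n)=e_i(m,n)$,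 $E_i^*(m,n)=e_i^*(m,n)$. If $n\in\Lambda(q)$ set $F_{ij}(m,n)=f_{ij}(m,n)$ and $E_0(m,n)=e_0(m,n)$; if $n\in\mathbb{Z}\setminus\Lambda(q)$ set $F_{ij}(m,n)=f_{ij}(m,n)-\frac12\delta_{ij}\delta_{m,0}\frac{q^n+1}{q^n-1}$ and $E_0(m,n)=e_0(m,n)-\frac12\delta_{m,0}\frac{q^n+1}{q^n-1}$. *)

(* Defs.v *)
From HB Require Import structures.
From mathcomp Require Import all_boot all_order all_algebra finmap.
From mathcomp Require Import boolp classical_sets fsbigop.
From mathcomp Require Import monalg ring.

Set Implicit Arguments.
Unset Strict Implicit.
Unset Printing Implicit Defensive.

Import GRing.Theory.
Local Open Scope ring_scope.

(* The vector space with basis I: an alias of {malg K[I]} whose scaling and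
   basis vectors are locked, as a failing conversion between two terms built
   with mkmalgU takes minutes. *)
Definition free (K : fieldType) (I : choiceType) : Type := {malg K[I]}.

HB.lock Definition fscale (K : fieldType) (I : choiceType) (c : K)
  (g : free K I) : free K I := c *: (g : {malg K[I]}).

HB.lock Definition fbasis (K : fieldType) (I : choiceType) (i : I)
  : free K I := << i >>.

Section FreeSpace.
Context (K : fieldType) (I : choiceType).
Implicit Types (g : free K I).

HB.instance Definition _ := GRing.Zmodule.copy (free K I) {malg K[I]}.

Definition fcoef (i : I) g : K := g@_i.

Lemma fcoefZ i c g : fcoef i (fscale c g) = c * fcoef i g.
Proof. by rewrite fscale.unlock; exact: mcoeffZ. Qed.

Lemma fcoefD i g1 g2 : fcoef i (g1 + g2) = fcoef i g1 + fcoef i g2.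
Proof. exact: mcoeffD. Qed.

Lemma fcoef0 i : fcoef i 0 = 0.
Proof. exact: mcoeff0. Qed.

Lemma fcoef_basis i j : fcoef i (fbasis K j) = (j == i)%:R.
Proof. by rewrite fbasis.unlock; exact: mcoeffU. Qed.

Lemma free_eqP g1 g2 : (forall i, fcoef i g1 = fcoef i g2) -> g1 = g2.
Proof. by move=> e; apply/malgP. Qed.

Lemma fscaleA c1 c2 g : fscale c1 (fscale c2 g) = fscale (c1 * c2) g.
Proof. by apply: free_eqP => i; rewrite !fcoefZ mulrA. Qed.

Lemma fscale1 : left_id 1 (@fscale K I).
Proof. by move=> g; apply: free_eqP => i; rewrite fcoefZ mul1r. Qed.

Lemma fscaleDr : right_distributive (@fscale K I) +%R.
Proof.
by move=> c g1 g2; apply: free_eqP => i; rewrite !(fcoefZ, fcoefD) mulrDr.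
Qed.

Lemma fscaleDl g : {morph (@fscale K I)^~ g : c1 c2 / c1 + c2}.
Proof.
by move=> c1 c2; apply: free_eqP => i; rewrite !(fcoefZ, fcoefD) mulrDl.
Qed.

HB.instance Definition _ := GRing.Zmodule_isLmodule.Build K (free K I)
  fscaleA fscale1 fscaleDr fscaleDl.

Lemma fcoef_linear i : scalar (fcoef i).
Proof. by move=> c g1 g2; rewrite fcoefD [fcoef i (_ *: _)]fcoefZ. Qed.

HB.instance Definition _ i :=
  GRing.isLinear.Build K (free K I) K *%R (fcoef i) (fcoef_linear i).

Lemma free_sumE g : g = \sum_(k <- msupp g) fcoef k g *: fbasis K k.
Proof.
apply: free_eqP => i; rewrite linear_sum /= {1}/fcoef {1}[g]monalgE raddf_sum.
apply: eq_bigr => k _.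
by rewrite linearZ /= fcoef_basis mcoeffU mulr_natr.
Qed.

End FreeSpace.

Section LinearExtension.
Context (K : fieldType) (I : choiceType) (W : lmodType K).
Implicit Types (h : I -> W) (g : free K I).

Definition lext h g : W := \sum_(k <- msupp g) fcoef k g *: h k.

Lemma lextEw h g (d : {fset I}) :
  (msupp g `<=` d)%fset -> lext h g = \sum_(k <- d) fcoef k g *: h k.
Proof.
move=> le; rewrite [LHS](big_fset_incl _ le) => //= x xd /mcoeff_outdom.
by rewrite /fcoef => ->; rewrite scale0r.
Qed.

Lemma lext_is_linear h : linear (lext h).
Proof.
move=> c g1 g2; set d := (msupp g1 `|` msupp g2)%fset.
have le3 : (msupp (c *: g1 + g2) `<=` d)%fset.
  apply: fsubset_trans (msuppD_le _ _) _; apply/fsetSU.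
  by rewrite -[c *: g1]/(fscale c g1) fscale.unlock; apply: msuppZ_le.
rewrite (lextEw h le3) (lextEw h (fsubsetUl _ _ : (msupp g1 `<=` d)%fset)).
rewrite (lextEw h (fsubsetUr _ _ : (msupp g2 `<=` d)%fset)).
rewrite scaler_sumr -big_split /=; apply: eq_bigr => k _.
by rewrite fcoefD fcoefZ scalerDl scalerA.
Qed.

HB.instance Definition _ h :=
  GRing.isLinear.Build K (free K I) W *:%R (lext h) (lext_is_linear h).

Lemma lextU h k : lext h (fbasis K k) = h k.
Proof.
have e : msupp (fbasis K k) = [fset k]%fset.
  by rewrite fbasis.unlock msuppU oner_eq0.
by rewrite /lext e big_seq_fset1 fcoef_basis eqxx scale1r.
Qed.

Lemma eq_lext h1 h2 : h1 =1 h2 -> lext h1 =1 lext h2.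
Proof. by move=> h12 g; apply: eq_bigr => k _; rewrite h12. Qed.

Lemma lext_Dl h1 h2 g : lext (fun k => h1 k + h2 k) g = lext h1 g + lext h2 g.
Proof. by rewrite -big_split /=; apply: eq_bigr => k _; rewrite scalerDr. Qed.

Lemma lext_Zl c h g : lext (fun k => c *: h k) g = c *: lext h g.
Proof.
by rewrite scaler_sumr; apply: eq_bigr => k _; rewrite !scalerA mulrC.
Qed.

Lemma lext_linE (f : free K I -> W) :
  linear f -> f =1 lext (fun k => f (fbasis K k)).
Proof.
move=> fL g; pose F : {linear free K I -> W} :=
  HB.pack f (GRing.isLinear.Build K _ W *:%R f fL).
rewrite -[f]/(F : _ -> _) {1}[g]free_sumE linear_sum; apply: eq_bigr => k _.
by rewrite linearZ.
Qed.

Lemma lext_lin_eq (f1 f2 : free K I -> W) : linear f1 -> linear f2 ->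
  (forall k, f1 (fbasis K k) = f2 (fbasis K k)) -> f1 =1 f2.
Proof.
by move=> L1 L2 e g; rewrite (lext_linE L1) (lext_linE L2); apply: eq_lext.
Qed.

End LinearExtension.

(* The quantum torus: (m, n) stands for the monomial x^m y^n, and
   x^m y^n x^p y^s = q^(n p) x^(m + p) y^(n + s) since y x = q x y. *)
Definition qtorus (K : fieldType) (q : K) (q0 : q != 0) : Type :=
  free K (int * int)%type.

Section QuantumTorus.
Context (K : fieldType) (q : K) (q0 : q != 0).
Local Notation Cq := (qtorus q0).

HB.instance Definition _ := GRing.Lmodule.copy Cq (free K (int * int)%type).

Definition mon (m n : int) : Cq := fbasis K (m, n).

Definition qt_mul (a b : Cq) : Cq :=
  lext (fun u => lext (fun v =>
    q ^ (u.2 * v.1) *: mon (u.1 + v.1) (u.2 + v.2)) b : Cq) a.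

Lemma qt_mul_linl b : linear (qt_mul^~ b).
Proof. by move=> c a1 a2; rewrite /qt_mul linearP. Qed.

Lemma qt_mul_linr a : linear (qt_mul a).
Proof.
move=> c b1 b2; rewrite /qt_mul -lext_Zl -lext_Dl; apply: eq_lext => u.
by rewrite linearP.
Qed.

Lemma qt_mul_mon m n p s :
  qt_mul (mon m n) (mon p s) = q ^ (n * p) *: mon (m + p) (n + s).
Proof. by rewrite /qt_mul !lextU. Qed.

Lemma qt_lin_eq (W : lmodType K) (f1 f2 : Cq -> W) : linear f1 -> linear f2 ->
  (forall m n, f1 (mon m n) = f2 (mon m n)) -> f1 =1 f2.
Proof. move=> L1 L2 e; apply: lext_lin_eq => // -[m n]; exact: e. Qed.

Lemma qt_mulZl c a b : qt_mul (c *: a) b = c *: qt_mul a b.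
Proof. by rewrite /qt_mul linearZ. Qed.

Lemma qt_mulZr c a b : qt_mul a (c *: b) = c *: qt_mul a b.
Proof. by rewrite /qt_mul -lext_Zl; apply: eq_lext => u; rewrite linearZ. Qed.

Lemma qt_mulA : associative qt_mul.
Proof.
move=> a b c; move: a; apply: qt_lin_eq => [k a1 a2|k a1 a2|m n].
- exact: qt_mul_linl.
- by rewrite (qt_mul_linl b) (qt_mul_linl c).
move: b; apply: qt_lin_eq => [k a1 a2|k a1 a2|p s].
- by rewrite (qt_mul_linl c) qt_mul_linr.
- by rewrite qt_mul_linr (qt_mul_linl c).
move: c; apply: qt_lin_eq => [k a1 a2|k a1 a2|i j].
- by rewrite !qt_mul_linr.
- by rewrite !qt_mul_linr.
rewrite !(qt_mul_mon, qt_mulZl, qt_mulZr) !scalerA -!expfzDr //.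
by congr (q ^ _ *: mon _ _); ring.
Qed.

Lemma qt_mul1 : left_id (mon 0 0) qt_mul.
Proof.
apply: qt_lin_eq => [|//|m n]; first exact: qt_mul_linr.
by rewrite qt_mul_mon mul0r expr0z scale1r !add0r.
Qed.

Lemma qt_mulr1 : right_id (mon 0 0) qt_mul.
Proof.
apply: (qt_lin_eq (f2 := id)) => [|//|m n]; first exact: qt_mul_linl.
by rewrite qt_mul_mon mulr0 expr0z scale1r !addr0.
Qed.

Lemma qt_mulDl : left_distributive qt_mul +%R.
Proof. by move=> a b c; have := qt_mul_linl c 1 a b; rewrite !scale1r. Qed.

Lemma qt_mulDr : right_distributive qt_mul +%R.
Proof. by move=> a b c; have := qt_mul_linr a 1 b c; rewrite !scale1r. Qed.

Lemma qt_1neq0 : mon 0 0 != 0.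
Proof.
apply/eqP => /(congr1 (fcoef (0, 0))) /eqP.
by rewrite fcoef_basis eqxx fcoef0 oner_eq0.
Qed.

HB.instance Definition _ := GRing.Zmodule_isNzRing.Build Cq
  qt_mulA qt_mul1 qt_mulr1 qt_mulDl qt_mulDr qt_1neq0.

Lemma qt_scaleAl (c : K) (a b : Cq) : c *: (a * b) = c *: a * b.
Proof. exact/esym/qt_mulZl. Qed.

HB.instance Definition _ := GRing.Lmodule_isLalgebra.Build K Cq qt_scaleAl.

Lemma qt_scaleAr (c : K) (a b : Cq) : c *: (a * b) = a * (c *: b).
Proof. exact/esym/qt_mulZr. Qed.

HB.instance Definition _ := GRing.Lalgebra_isAlgebra.Build K Cq qt_scaleAr.

(* bar (x^m y^n) = (bar y)^n (bar x)^m = y^(-n) x^m *)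
Definition bar (a : Cq) : Cq := lext (fun u => mon 0 (- u.2) * mon u.1 0) a.

Lemma monM m n p s : mon m n * mon p s = q ^ (n * p) *: mon (m + p) (n + s).
Proof. exact: qt_mul_mon. Qed.

Lemma bar_linear : linear bar.
Proof. by move=> c a b; rewrite /bar linearP. Qed.

HB.instance Definition _ :=
  GRing.isLinear.Build K Cq Cq *:%R bar bar_linear.

Lemma bar_mon m n : bar (mon m n) = mon 0 (- n) * mon m 0.
Proof. by rewrite /bar lextU. Qed.

Lemma barM a b : bar (a * b) = bar b * bar a.
Proof.
move: a; apply: qt_lin_eq => [c a1 a2|c a1 a2|m n].
- by rewrite mulrDl -scalerAl linearP.
- by rewrite linearP mulrDr scalerAr.
move: b; apply: qt_lin_eq => [c a1 a2|c a1 a2|p s].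
- by rewrite mulrDr -scalerAr linearP.
- by rewrite linearP mulrDl scalerAl.
rewrite monM linearZ /= !bar_mon !monM -?scalerAl -?scalerAr monM !scalerA.
rewrite -!expfzDr //.
by congr (q ^ _ *: mon _ _); ring.
Qed.

Lemma barK : involutive bar.
Proof.
apply: (qt_lin_eq (f2 := id)) => [c a b|//|m n]; first by rewrite !linearP.
by rewrite bar_mon barM !bar_mon !oppr0 opprK !monM !mulr0 !mul0r expr0z
  !scale1r !add0r !addr0 monM mulr0 ?mul0r expr0z scale1r add0r addr0.
Qed.

End QuantumTorus.

(* Matrices over the quantum torus, as a vector space over K. *)
Definition gl (K : fieldType) (q : K) (q0 : q != 0) (r : nat) : Type :=
  'M[qtorus q0]_r.

Section GlK.
Context (K : fieldType) (q : K) (q0 : q != 0) (r : nat).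
Local Notation gl := (gl q0 r).

HB.instance Definition _ := GRing.Zmodule.copy gl 'M[qtorus q0]_r.

Definition gl_scale (c : K) (A : gl) : gl :=
  map_mx (fun a : qtorus q0 => c *: a) A.

Lemma gl_scaleA b c A : gl_scale b (gl_scale c A) = gl_scale (b * c) A.
Proof. by apply/matrixP => i j; rewrite /gl_scale !mxE scalerA. Qed.

Lemma gl_scale1 : left_id 1 gl_scale.
Proof. by move=> A; apply/matrixP => i j; rewrite /gl_scale !mxE scale1r. Qed.

Lemma gl_scaleDr : right_distributive gl_scale +%R.
Proof. by move=> c A B; apply/matrixP => i j; rewrite /gl_scale !mxE scalerDr. Qed.

Lemma gl_scaleDl A : {morph gl_scale^~ A : b c / b + c}.
Proof. by move=> b c; apply/matrixP => i j; rewrite /gl_scale !mxE scalerDl. Qed.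

HB.instance Definition _ := GRing.Zmodule_isLmodule.Build K gl
  gl_scaleA gl_scale1 gl_scaleDr gl_scaleDl.

Definition eij (i j : 'I_r) (a : qtorus q0) : gl :=
  a *: (delta_mx i j : 'M[qtorus q0]_r).

Definition comm (A B : gl) : gl :=
  (A : 'M_r) *m (B : 'M_r) - (B : 'M_r) *m (A : 'M_r).

End GlK.

Definition Lambda (K : fieldType) (q : K) : Type := {n : int | q ^ n == 1}.
HB.instance Definition _ (K : fieldType) (q : K) :=
  SubChoice.copy (Lambda q) {n : int | q ^ n == 1}.

Definition glhat (K : fieldType) (q : K) (q0 : q != 0) (r : nat) : Type :=
  (gl q0 r * free K (Lambda q) * K^o)%type.

Section GlHat.
Context (K : fieldType) (q : K) (q0 : q != 0) (r : nat).
Local Notation gl := (gl q0 r).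
Local Notation glhat := (glhat q0 r).

HB.instance Definition _ :=
  GRing.Lmodule.copy glhat (gl * free K (Lambda q) * K^o)%type.

Definition glin (A : gl) : glhat := (A, 0, 0).
Definition cn (n : Lambda q) : glhat := (0, fbasis K n, 0).
Definition cy : glhat := (0, 0, 1).

(* c(t), understood as 0 when t is not in Lambda(q) *)
Definition cnz (t : int) : glhat := if insub t is Some n then cn n else 0.

(* [e_ij(x^m y^n), e_kl(x^p y^s)] *)
Definition br_mon (i j k l : 'I_r) (m n p s : int) : glhat :=
    ((j == k)%:R * q ^ (n * p)) *: glin (eij i l (mon q0 (m + p) (n + s)))
  - ((i == l)%:R * q ^ (m * s)) *: glin (eij k j (mon q0 (m + p) (n + s)))
  + (m%:~R * q ^ (n * p) * (j == k)%:R * (i == l)%:R * (m + p == 0)%:R)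
      *: cnz (n + s)
  + (n%:~R * q ^ (n * p) * (j == k)%:R * (i == l)%:R * (m + p == 0)%:R
      * (n + s == 0)%:R) *: cy.

Definition hbr (X Y : glhat) : glhat :=
  \sum_i \sum_j \sum_k \sum_l
    lext (fun u => lext (fun v => br_mon i j k l u.1 u.2 v.1 v.2)
                     (Y.1.1 k l)) (X.1.1 i j).

Lemma eijE (i j : 'I_r) (a : qtorus q0) (k l : 'I_r) :
  eij i j a k l = if (i == k) && (j == l) then a else 0.
Proof.
rewrite /eij !mxE (eq_sym k) (eq_sym l).
by case: ifP => _; rewrite ?mulr1 ?mulr0.
Qed.

Lemma sum4_eq (W : zmodType) (F : 'I_r -> 'I_r -> 'I_r -> 'I_r -> W) i j k l :
  (forall i' j' k' l', ~~ [&& i == i', j == j', k == k' & l == l'] ->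
     F i' j' k' l' = 0) ->
  \sum_i' \sum_j' \sum_k' \sum_l' F i' j' k' l' = F i j k l.
Proof.
move=> F0; rewrite (bigD1 i) //= (bigD1 j) //= (bigD1 k) //= (bigD1 l) //=.
rewrite !big1 ?addr0 // => [i' ni|j' nj|k' nk|l' nl].
- rewrite big1 // => j' _; rewrite big1 // => k' _; rewrite big1 // => l' _.
  by apply: F0; rewrite eq_sym (negbTE ni).
- rewrite big1 // => k' _; rewrite big1 // => l' _.
  by apply: F0; rewrite (eq_sym j) (negbTE nj) andbF.
- rewrite big1 // => l' _.
  by apply: F0; rewrite (eq_sym k) (negbTE nk) !andbF.
- by apply: F0; rewrite (eq_sym l) (negbTE nl) !andbF.
Qed.

Lemma hbr_mon i j k l m n p s :
  hbr (glin (eij i j (mon q0 m n))) (glin (eij k l (mon q0 p s))) =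
  br_mon i j k l m n p s.
Proof.
rewrite /hbr (sum4_eq (i := i) (j := j) (k := k) (l := l)).
  by rewrite !eijE !eqxx !lextU.
move=> i' j' k' l' ne; rewrite !eijE; move: ne; rewrite andbA.
case: ((i == i') && _) => /= [|_]; last by rewrite linear0.
move=> /negbTE ->; rewrite /lext big1 // => w _.
by rewrite msupp0 big_seq_fset0 scaler0.
Qed.

End GlHat.

Arguments cn {K q} q0 r n.
Arguments cy {K q} q0 r.
Arguments hbr {K q} q0 r X Y.

Section GPrime.
Context (K : fieldType) (q : K) (q0 : q != 0) (N : nat).
Local Notation Cq := (qtorus q0).
Local Notation r := (1 + (N + N))%N.
Local Notation gl := (gl q0 r).
Local Notation glhat := (glhat q0 r).

(* For i : 'I_N (numbered from 0), ipos i and ineg i are the indices written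
   i and N + i in the 1-based numbering 1 <= i <= N. *)
Definition izero : 'I_r := lshift (N + N) (ord0 : 'I_1).
Definition ipos (i : 'I_N) : 'I_r := rshift 1 (lshift N i).
Definition ineg (i : 'I_N) : 'I_r := rshift 1 (rshift N i).

Definition Gmx : 'M[K]_r := block_mx 1%:M 0 0 (block_mx 0 1%:M 1%:M 0).

Definition star (A : gl) : gl :=
  map_mx (fun c : K => c%:A : Cq) (invmx Gmx) *m (map_mx (@bar K q q0) A)^T
  *m map_mx (fun c : K => c%:A : Cq) Gmx.

Definition Sset : set gl := fun A => star A = - A.

(* G' = [S, S], the span of the commutators *)
Definition Gprime : set gl := fun A =>
  exists (k : nat) (c : 'I_k -> K) (B C : 'I_k -> gl),
    (forall i, Sset (B i) /\ Sset (C i)) /\ A = \sum_i c i *: comm (B i) (C i).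

(* S and G' with the whole centre added *)
Definition Shat : set glhat := fun X => Sset X.1.1.
Definition Gprime_hat : set glhat := fun X => Gprime X.1.1.

Definition ftil (i j : 'I_N) (m n : int) : gl :=
  eij (ipos i) (ipos j) (mon q0 m n) - eij (ineg j) (ineg i) (bar (mon q0 m n)).
Definition gtil (i j : 'I_N) (m n : int) : gl :=
  eij (ipos i) (ineg j) (mon q0 m n) - eij (ipos j) (ineg i) (bar (mon q0 m n)).
Definition htil (i j : 'I_N) (m n : int) : gl :=
  eij (ineg i) (ipos j) (mon q0 m n) - eij (ineg j) (ipos i) (bar (mon q0 m n)).
Definition etil (i : 'I_N) (m n : int) : gl :=
  eij (ipos i) izero (mon q0 m n) - eij izero (ineg i) (bar (mon q0 m n)).
Definition estil (i : 'I_N) (m n : int) : gl :=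
  eij (ineg i) izero (mon q0 m n) - eij izero (ipos i) (bar (mon q0 m n)).
Definition e0til (m n : int) : gl :=
  eij izero izero (mon q0 m n - bar (mon q0 m n)).

End GPrime.

Arguments Shat {K q} q0 N.
Arguments Gprime_hat {K q} q0 N.

Section AlphaModules.
Context (K : fieldType) (N : nat) (V : lmodType K).

(* An alpha'(N)-module structure on V is given by the operators by which the
   generators act, subject to the defining relations of alpha'(N). *)
Record alpha_ops := AlphaOps {
  op_a : 'I_N -> int -> {linear V -> V};
  op_as : 'I_N -> int -> {linear V -> V};
  op_e : int -> {linear V -> V} }.

Definition acomm (f g : V -> V) : V -> V := fun v => f (g v) + g (f v).

Record alpha_module (A : alpha_ops) : Prop := {
  rel_aa : forall i j m n v, acomm (op_a A i m) (op_a A j n) v = 0;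
  rel_asas : forall i j m n v, acomm (op_as A i m) (op_as A j n) v = 0;
  rel_aas : forall i j m n v, acomm (op_a A i m) (op_as A j n) v =
    ((i == j)%:R * (m + n == 0)%:R) *: v;
  rel_ee : forall m n v, acomm (op_e A m) (op_e A n) v = (m + n == 0)%:R *: v;
  rel_ae : forall i m n v, acomm (op_a A i m) (op_e A n) v = 0;
  rel_ase : forall i m n v, acomm (op_as A i m) (op_e A n) v = 0 }.

Record alpha_submodule (A : alpha_ops) (W : set V) : Prop := {
  asub_0 : W 0;
  asub_lin : forall c u v, W u -> W v -> W (c *: u + v);
  asub_a : forall i m v, W v -> W (op_a A i m v);
  asub_as : forall i m v, W v -> W (op_as A i m v);
  asub_e : forall m v, W v -> W (op_e A m v) }.

Record vacuum_module (A : alpha_ops) (v0 : V) : Prop := {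
  vac_rel : alpha_module A;
  vac_neq0 : v0 != 0;
  vac_a : forall i (n : int), 0 < n -> op_a A i n v0 = 0;
  vac_as : forall i (n : int), 0 <= n -> op_as A i n v0 = 0;
  vac_e : forall n : int, 0 < n -> op_e A n v0 = 0;
  vac_e0 : exists c : K, op_e A 0 v0 = c *: v0;
  vac_gen : forall W, alpha_submodule A W -> W v0 -> W = setT;
  vac_simple : forall W, alpha_submodule A W -> W = [set 0]%classic \/ W = setT
}.

(* :u(m)v(n): *)
Definition nord (u w : int -> V -> V) (m n : int) : V -> V := fun v =>
  if m < n then u m (w n v)
  else if m == n then 2^-1 *: (u m (w n v) - w n (u m v))
  else - w n (u m v).

(* The sum over s is finite on each vector of a vacuum module; the finitely
   supported big operator is by convention 0 on infinite supports. *)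
Definition quad (q : K) (u w : int -> V -> V) (m n : int) (v : V) : V :=
  \sum_(s \in [set: int]) q ^ (- (n * s)) *: nord u w (m - s) s v.

(* Half of (q^n + 1) / (q^n - 1), read as 0 when n is in Lambda(q) *)
Definition fshift (q : K) (n : int) : K :=
  if q ^ n == 1 then 0 else 2^-1 * ((q ^ n + 1) / (q ^ n - 1)).

Section Operators.
Context (q : K) (A : alpha_ops).
Local Notation a := (op_a A).
Local Notation as_ := (op_as A).
Local Notation e := (op_e A).

Definition opF (i j : 'I_N) (m n : int) (v : V) : V :=
  quad q (a i) (as_ j) m n v
  - ((i == j)%:R * (m == 0)%:R * fshift q n) *: v.
Definition opG (i j : 'I_N) (m n : int) : V -> V := quad q (a i) (a j) m n.
Definition opH (i j : 'I_N) (m n : int) : V -> V := quad q (as_ i) (as_ j) m n.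
Definition opE (i : 'I_N) (m n : int) : V -> V := quad q (a i) e m n.
Definition opEs (i : 'I_N) (m n : int) : V -> V := quad q (as_ i) e m n.
Definition opE0 (m n : int) (v : V) : V :=
  quad q e e m n v - ((m == 0)%:R * fshift q n) *: v.

End Operators.
End AlphaModules.

Section LieModule.
Context (K : fieldType) (L V : lmodType K).

(* rho is bilinear as a map D x V -> V, for D a subspace of L *)
Record bilinear_on (D : set L) (rho : L -> V -> V) : Prop := {
  bil_r : forall x, D x -> linear (rho x);
  bil_l : forall c x y v, D x -> D y ->
    rho (c *: x + y) v = c *: rho x v + rho y v }.

(* V is a module, via rho, for the Lie algebra D with bracket br *)
Record lie_module (br : L -> L -> L) (D : set L) (rho : L -> V -> V) : Prop := {
  lie_bilin : bilinear_on D rho;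
  lie_br : forall x y v, D x -> D y ->
    rho (br x y) v = rho x (rho y v) - rho y (rho x v) }.

End LieModule.

(* Main.v *)
From HB Require Import structures.
Require Import Defs.
From mathcomp Require Import all_boot all_order all_algebra.
From mathcomp Require Import reals classical_sets.
From mathcomp Require Import complex.
From mathcomp Require Import boolp fsbigop zify ring.

(* Write phi_I for the fields e, a_i, a_i^*, indexed like the rows of the
   matrices, and I' for the index dual to I, so that
   {phi_I(m), phi_J(n)} = delta_(J,I') delta_(m+n,0).  The elements
   e_IJ(x^m y^n) act by half of the regularised quadratic operator
   Q_IJ(m, n) = sum_s q^(-ns) :phi_I(m-s) phi_J'(s): - shift.
   On a given vector Q_IJ(m, n) agrees with the sum of q^(-ns) phi_I(m-s)
   phi_J'(s) over a large finite window of s up to a scalar depending only on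
   the lower end of the window.  The commutator of Q_IJ(m, n) with such a
   window sum is computed from its commutators with the fields; it is a
   combination of window sums two of which are translated by m, and the change
   of the scalar under translation is the central term.  Since Q_IJ(m, n) is
   anti-invariant under the involution defining S, these formulas give the
   bracket relation for X in S. *)

Set Implicit Arguments.
Unset Strict Implicit.
Unset Printing Implicit Defensive.

Import Order.TTheory GRing.Theory Num.Theory.
Local Open Scope ring_scope.

(** * Sums over the integers and finite windows *)

Lemma linear_sum_fun (K : nzRingType) (V W : lmodType K) (f : V -> W)
    (I : finType) (F : I -> V) :
  linear f -> f (\sum_i F i) = \sum_i f (F i).
Proof.
move=> fL; pose G : {linear V -> W} :=
  HB.pack f (GRing.isLinear.Build K V W *:%R f fL).
rewrite -[f]/(G : _ -> _); exact: linear_sum.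
Qed.

Lemma linear_sumZ (K : nzRingType) (V W : lmodType K) (f : V -> W) (L : nat)
    (c : 'I_L -> K) (x : 'I_L -> V) :
  linear f -> f (\sum_k c k *: x k) = \sum_k c k *: f (x k).
Proof.
move=> fL; pose F : {linear V -> W} :=
  HB.pack f (GRing.isLinear.Build K V W *:%R f fL).
rewrite -[f]/(F : _ -> _) linear_sum; apply: eq_bigr => k _; exact: linearZ.
Qed.

(** Any window outside which the terms vanish computes the sum, so one window can serve several
    operators or vectors at once. *)
Lemma fsbig_window (V : nmodType) (F : int -> V) (al : int) (L : nat) :
  (forall s : int, s < al -> F s = 0) ->
  (forall s : int, al + L%:Z <= s -> F s = 0) ->
  \sum_(s \in [set: int]) F s = \sum_(k < L) F (al + k%:Z).
Proof.
move=> Flo Fhi.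
rewrite (@fsbigE _ _ _ _ _ [seq al + k%:Z | k <- iota 0 L]) //.
- rewrite big_map (eq_bigl xpredT) => [|k]; last exact/asboolP.
  by rewrite -[L in iota 0 L]subn0 -/(index_iota 0 L) big_mkord.
- rewrite map_inj_uniq ?iota_uniq // => i j; lia.
- move=> s _ /mapP ns.
  have [/Flo //|als] := ltP s al; have [/Fhi //|sal] := leP (al + L%:Z) s.
  case: ns; exists (`|s - al|%N); last by lia.
  by rewrite mem_iota; lia.
Qed.

Section WindowSum.
Context (V : nmodType).
Implicit Types (F : int -> V).

Lemma window_rev F (m al : int) (L : nat) :
  \sum_(k < L) F (m - (al + k%:Z)) =
  \sum_(k < L) F (m - al - L%:Z + 1 + k%:Z).
Proof.
rewrite (reindex_inj rev_ord_inj) /=; apply: eq_bigr => k _.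
by congr F; have := ltn_ord k; lia.
Qed.

Lemma window_delta F (al t : int) (L : nat) : al <= t -> t < al + L%:Z ->
  (forall s, s != t -> F s = 0) -> \sum_(k < L) F (al + k%:Z) = F t.
Proof.
move=> lo hi F0; have lt : (`|t - al| < L)%N by lia.
rewrite (bigD1 (Ordinal lt)) //= big1 ?addr0 => [|k /eqP ne].
  by congr F; lia.
by apply: F0; apply/eqP => e; apply: ne; apply: val_inj => /=; lia.
Qed.

End WindowSum.

(* [step s] is the contraction subtracted from [u (m - s) w s] by normal
   ordering, and [defect q n al] is the sum of [q ^ (- (n * s)) * step s] over
   [s >= al], plus [fshift q n]. *)
Definition step (K : fieldType) (s : int) : K :=
  if s < 0 then 1 else if s == 0 then 2^-1 else 0.

Definition defect (K : fieldType) (q : K) (n al : int) : K :=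
  if q ^ n == 1 then 2^-1 - al%:~R else q ^ (n * (1 - al)) / (q ^ n - 1).

(** * Sums of contractions and their behaviour under translation *)

Section Regularisation.
Context (K : fieldType) (h2 : 2%:R != 0 :> K) (q : K) (q0 : q != 0).

Lemma defectB1 n al :
  defect q n (al - 1) = defect q n al + q ^ (- (n * (al - 1))).
Proof.
rewrite /defect; case: eqP => [qn|/eqP qn].
  rewrite -[- (n * _)]mulrN -[q ^ _]exprz_exp qn exp1rz intrD mulrNz; ring.
have -> : n * (1 - (al - 1)) = n + - (n * (al - 1)) by ring.
have -> : n * (1 - al) = - (n * (al - 1)) by ring.
by rewrite expfzDr //; field; rewrite subr_eq0.
Qed.

(** If q^n differs from 1, the half from the contraction at s = 0 and [fshift] add up to q^n / (q^n
    - 1). This cancels the constant term of the geometric sum and leaves [defect] a multiple of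
    q^(-(n al)). *)
Lemma defect0 n : defect q n 0 = 2^-1 + fshift q n.
Proof.
rewrite /defect /fshift; case: eqP => [|/eqP] qn; first by rewrite subr0 addr0.
by rewrite subr0 mulr1; field; rewrite subr_eq0 qn h2.
Qed.

(** A multiple of q^(-(n al)) is only rescaled by translation. When q^n = 1, [defect] is affine in
    al with slope -1, and the extra -m is the source of the central term. *)
Lemma defectD n m al :
  defect q n (m + al) =
  q ^ (- (n * m)) * defect q n al - (q ^ n == 1)%:R * m%:~R.
Proof.
rewrite /defect; case: eqP => [qn|qn].
  rewrite -[- (n * _)]mulrN -[q ^ _]exprz_exp qn exp1rz intrD /= mulr1n; ring.
by rewrite mul0r subr0 mulrA -expfzDr //; congr (q ^ _ / _); ring.
Qed.

(** Contractions vanish for s > 0, so the upper end does not matter. The induction lowers al with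
    the upper end fixed, which is why L varies. *)
Lemma window_step n (al : int) (L : nat) : al <= 0 -> 0 < al + L%:Z ->
  \sum_(k < L) q ^ (- (n * (al + k%:Z))) * step K (al + k%:Z) =
  defect q n al - fshift q n.
Proof.
move=> al0; have -> : al = - `|al|%:Z by lia.
elim: `|al|%N L => [|a IHa] [|L] //= aL.
  rewrite big_ord_recl /= big1 => [|k _]; last first.
    by rewrite /step /bump /= mulr0.
  rewrite /step /= defect0; rewrite oppr0 addr0 mulr0 oppr0 expr0z; ring.
rewrite big_ord_recl /= (eq_bigr (fun k : 'I_L =>
  q ^ (- (n * (- a%:Z + k%:Z))) * step K (- a%:Z + k%:Z))); last first.
  move=> k _; have -> // : - a.+1%:Z + (bump 0 k)%:Z = - a%:Z + k%:Z.
  by rewrite /bump /=; lia.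
rewrite IHa; last by lia.
have -> : - a.+1%:Z = - a%:Z - 1 by lia.
rewrite defectB1 addr0 /step ifT; last by lia.
ring.
Qed.

End Regularisation.

(** * The index set and its duality *)

Section Indices.
Context (N : nat).
Local Notation r := (1 + (N + N))%N.

(* The involution of the index set by which [Gmx] permutes the basis. *)
Definition dual_idx (i : 'I_r) : 'I_r :=
  match split i with
  | inl _ => i
  | inr k => match split k with inl j => ineg j | inr j => ipos j end
  end.

Lemma idx_ind (P : 'I_r -> Prop) :
  P (izero N) -> (forall i, P (ipos i)) -> (forall i, P (ineg i)) ->
  forall i, P i.
Proof.
move=> P0 Pp Pn i; case: (split_ordP i) => [z ->|k ->]; first by rewrite ord1.
by case: (split_ordP k) => j ->; [apply: Pp|apply: Pn].
Qed.

Lemma split_izero : split (izero N) = inl ord0.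
Proof. exact: (unsplitK (inl ord0)). Qed.

Lemma split_ipos i : split (ipos i) = inr (lshift N i).
Proof. exact: (unsplitK (inr (lshift N i))). Qed.

Lemma split_ineg i : split (ineg i) = inr (rshift N i).
Proof. exact: (unsplitK (inr (rshift N i))). Qed.

Lemma split_lshift (j : 'I_N) : split (lshift N j) = inl j.
Proof. exact: (unsplitK (inl j)). Qed.

Lemma split_rshift (j : 'I_N) : split (rshift N j) = inr j.
Proof. exact: (unsplitK (inr j)). Qed.

Definition split_idx :=
  (split_izero, split_ipos, split_ineg, split_lshift, split_rshift).

Lemma dual_zero : dual_idx (izero N) = izero N.
Proof. by rewrite /dual_idx split_idx. Qed.
Lemma dual_pos i : dual_idx (ipos i) = ineg i.
Proof. by rewrite /dual_idx !split_idx. Qed.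
Lemma dual_neg i : dual_idx (ineg i) = ipos i.
Proof. by rewrite /dual_idx !split_idx. Qed.

Definition dual_idxE := (dual_zero, dual_pos, dual_neg).

Lemma dual_idxK : involutive dual_idx.
Proof. by elim/idx_ind => [|i|i]; rewrite !dual_idxE. Qed.

Lemma dual_eq i j : (i == dual_idx j) = (dual_idx i == j).
Proof. by rewrite -{1}(dual_idxK i) (inj_eq (can_inj dual_idxK)). Qed.

Lemma pos_eq (i j : 'I_N) : (ipos i == ipos j) = (i == j).
Proof. by apply/eqP/eqP => [/rshift_inj/lshift_inj|->]. Qed.
Lemma neg_eq (i j : 'I_N) : (ineg i == ineg j) = (i == j).
Proof. by apply/eqP/eqP => [/rshift_inj/rshift_inj|->]. Qed.
Lemma zero_pos (i : 'I_N) : (izero N == ipos i) = false.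
Proof. by apply/eqP => /(congr1 val). Qed.
Lemma zero_neg (i : 'I_N) : (izero N == ineg i) = false.
Proof. by apply/eqP => /(congr1 val). Qed.
Lemma pos_neg (i j : 'I_N) : (ipos i == ineg j) = false.
Proof. by apply/eqP => /(congr1 val) /=; have := ltn_ord i; lia. Qed.
Lemma pos_zero (i : 'I_N) : (ipos i == izero N) = false.
Proof. by rewrite eq_sym zero_pos. Qed.
Lemma neg_zero (i : 'I_N) : (ineg i == izero N) = false.
Proof. by rewrite eq_sym zero_neg. Qed.
Lemma neg_pos (i j : 'I_N) : (ineg i == ipos j) = false.
Proof. by rewrite eq_sym pos_neg. Qed.

Definition idx_eqE := (pos_eq, neg_eq, zero_pos, zero_neg, pos_neg,
  pos_zero, neg_zero, neg_pos).

End Indices.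
Arguments dual_idxK {N}.

Lemma dual_idx_inj N : injective (@dual_idx N).
Proof. exact: can_inj dual_idxK. Qed.

(** * The fields and their anticommutators *)

Section Fields.
Context (K : fieldType) (N : nat) (V : lmodType K) (A : alpha_ops N V).
Local Notation r := (1 + (N + N))%N.

Definition fld (i : 'I_r) : int -> {linear V -> V} :=
  match split i with
  | inl _ => op_e A
  | inr k => match split k with inl j => op_a A j | inr j => op_as A j end
  end.

Lemma fld_zero : fld (izero N) = op_e A.
Proof. by rewrite /fld split_idx. Qed.
Lemma fld_pos i : fld (ipos i) = op_a A i.
Proof. by rewrite /fld !split_idx. Qed.
Lemma fld_neg i : fld (ineg i) = op_as A i.
Proof. by rewrite /fld !split_idx. Qed.

Definition fldE := (fld_zero, fld_pos, fld_neg).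

(** A single formula for the six families of relations; it spares a separate bracket computation for
    each kind of generator. *)
Lemma fld_anticomm : alpha_module A -> forall i j m n v,
  fld i m (fld j n v) + fld j n (fld i m v) =
  ((j == dual_idx i)%:R * (m + n == 0)%:R) *: v.
Proof.
case=> aa ss as_ ee ae se.
elim/idx_ind => [|i|i]; elim/idx_ind => [|j|j] m n v;
  rewrite !fldE !dual_idxE ?eqxx ?idx_eqE ?mul0r ?scale0r ?mul1r.
- exact: ee.
- by rewrite addrC; exact: ae.
- by rewrite addrC; exact: se.
- exact: ae.
- exact: aa.
- by rewrite eq_sym; exact: as_.
- exact: se.
- by rewrite [LHS]addrC [m + n]addrC; exact: as_.
- exact: ss.
Qed.

End Fields.

(** * Quadratic operators on the vacuum module *)

Section Fock.
Context (K : fieldType) (h2 : 2%:R != 0 :> K) (q : K) (q0 : q != 0).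
Context (N : nat) (V : lmodType K) (A : alpha_ops N V) (v0 : V).
Hypothesis hV : vacuum_module A v0.
Local Notation r := (1 + (N + N))%N.
Local Notation fld := (fld A).
Implicit Types (i j k l : 'I_r) (m n p s t al : int) (v w : V).

Let anticomm := fld_anticomm (vac_rel hV).

Lemma fld_swap i j m n v : fld i m (fld j n v) =
  ((j == dual_idx i)%:R * (m + n == 0)%:R) *: v - fld j n (fld i m v).
Proof. by rewrite -anticomm addrK. Qed.

Definition killed_above (T : int) v := forall i n, T < n -> fld i n v = 0.

Lemma killed_aboveW T T' v : T <= T' -> killed_above T v -> killed_above T' v.
Proof. by move=> TT' kv i n /(le_lt_trans TT')/kv. Qed.

Lemma killed_above_fld T v : killed_above T v ->
  forall i m, killed_above (Num.max T (- m)) (fld i m v).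
Proof.
move=> kv i m j n; rewrite gt_max => /andP[Tn mn].
have /negbTE mn0 : n + m != 0 by lia.
by rewrite fld_swap kv // linear0 mn0 mulr0 scale0r subr0.
Qed.

(** The vectors killed by all sufficiently high modes form a submodule containing [v0], which
    generates V. *)
Lemma locally_nilpotent v : exists2 T : int, 0 <= T & killed_above T v.
Proof.
suff: [set v | exists2 T : int, 0 <= T & killed_above T v]%classic = setT.
  by move/seteqP => [_] /(_ v); apply.
apply: (vac_gen hV); last first.
  exists 0 => // i n n0; elim/idx_ind: i => [|i|i]; rewrite !fldE.
  - exact: vac_e hV _ n0.
  - exact: vac_a hV _ _ n0.
  - exact: vac_as hV _ _ (ltW n0).
have sub i m w : (exists2 T : int, 0 <= T & killed_above T w) ->
    exists2 T : int, 0 <= T & killed_above T (fld i m w).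
  move=> [T T0 kv]; exists (Num.max T (- m)); first by rewrite le_max T0.
  exact: killed_above_fld.
split.
- by exists 0 => // i n _; rewrite linear0.
- move=> c u w [T T0 ku] [T' _ kw]; exists (Num.max T T').
    by rewrite le_max T0.
  move=> i n; rewrite gt_max => /andP[? ?].
  by rewrite linearP ku ?kw // scaler0 addr0.
- by move=> i m u; have := sub (ipos i) m u; rewrite fldE.
- by move=> i m u; have := sub (ineg i) m u; rewrite fldE.
- by move=> m u; have := sub (izero N) m u; rewrite fldE.
Qed.

Definition mode i j m s v : V := fld i (m - s) (fld (dual_idx j) s v).

Definition Qop i j m n v : V :=
  quad q (fld i) (fld (dual_idx j)) m n v
  - ((i == j)%:R * (m == 0)%:R * fshift q n) *: v.

(** Reordering costs the anticommutator, nonzero only for i = j and m = 0. There the order of the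
    modes -s and s is decided by the sign of s, which gives the three cases of [step]. *)
Lemma nordE i j m s v :
  nord (fld i) (fld (dual_idx j)) (m - s) s v =
  mode i j m s v - ((i == j)%:R * (m == 0)%:R * step K s) *: v.
Proof.
have -> : (i == j)%:R * (m == 0)%:R * step K s =
   (dual_idx j == dual_idx i)%:R * (m - s + s == 0)%:R * step K s.
  by rewrite (inj_eq (@dual_idx_inj N)) subrK eq_sym.
rewrite /nord /mode /step; case: (ltgtP (m - s) s) => [lt|lt|e].
- case: (m - s + s =P 0) => [e|_]; last by rewrite mulr0 mul0r scale0r subr0.
  by rewrite ifF ?ifF ?mulr0 ?scale0r ?subr0 //; lia.
- rewrite [X in _ = X - _]fld_swap.
  case: (m - s + s =P 0) => [e|_]; last first.
    by rewrite mulr0 mul0r scale0r !add0r subr0.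
  have s0 : s < 0 by lia.
  by rewrite s0 !mulr1 [RHS]addrC addKr.
(* Equal modes: if m is nonzero the fields anticommute and the halved difference is the product
   itself; if m = 0, half of the contraction is subtracted. *)
- have half x : 2^-1 *: (x + x) = x :> V.
    by rewrite -mulr2n -scaler_nat scalerA mulVf // scale1r.
  have := fld_swap i (dual_idx j) (m - s) s v.
  case: (m - s + s =P 0) => [ms|_]; last first.
    by rewrite !(mulr0, mul0r) scale0r sub0r subr0 => <-; rewrite half.
  have s0 : s = 0 by lia.
  rewrite [if _ then _ else _]ifF ?ifT ?s0 // -s0 mulr1; set c := _%:R => xE.
  rewrite mulrC -scalerA.
  rewrite -(subrK (fld (dual_idx j) s (fld i (m - s) v)) (c *: v)).
  rewrite -xE; set x := fld i _ _; set y := fld (dual_idx j) _ _.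
  by rewrite -{2}[x]half -scalerBr opprD addrACA subrr add0r.
Qed.

(** Here the mode m - s kills v, so the product reduces to its contraction, which normal ordering
    removes. *)
Lemma nord_lo i j m s v T : killed_above T v -> s < 0 -> s < m - T ->
  nord (fld i) (fld (dual_idx j)) (m - s) s v = 0.
Proof.
move=> kv s0 sT; rewrite nordE /mode fld_swap [fld i _ v]kv; last by lia.
rewrite linear0 subr0 subrK (inj_eq (@dual_idx_inj N)) [j == i]eq_sym.
by rewrite /step s0 mulr1 subrr.
Qed.

Lemma nord_hi i j m s v T : killed_above T v -> 0 < s -> T < s ->
  nord (fld i) (fld (dual_idx j)) (m - s) s v = 0.
Proof.
move=> kv s0 Ts; rewrite nordE /mode [fld _ s v]kv // linear0 sub0r.
by rewrite /step ifF ?ifF ?mulr0 ?scale0r ?oppr0 //; lia.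
Qed.

(** The products are not normally ordered, so that commutators with them can be computed factor by
    factor. *)
Definition wsum i j m n al L v : V :=
  \sum_(x < L) q ^ (- (n * (al + x%:Z))) *: mode i j m (al + x%:Z) v.

Lemma quadE i j m n v T al L : killed_above T v -> al <= 0 -> al <= m - T ->
  0 < al + L%:Z -> T < al + L%:Z ->
  quad q (fld i) (fld (dual_idx j)) m n v =
  \sum_(x < L) q ^ (- (n * (al + x%:Z))) *:
    nord (fld i) (fld (dual_idx j)) (m - (al + x%:Z)) (al + x%:Z) v.
Proof.
move=> kv al0 alT L0 LT; rewrite /quad.
apply: (fsbig_window (F := fun s => q ^ (- (n * s)) *: nord _ _ (m - s) s v)).
  by move=> s sal; rewrite (nord_lo _ _ kv) ?scaler0 //; lia.
by move=> s sal; rewrite (nord_hi _ _ _ kv) ?scaler0 //; lia.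
Qed.

(** By [window_step] the contractions over the window add up to [defect] minus [fshift], and the
    shift in [Qop] absorbs the latter. *)
Lemma wsumE i j m n v T al L : killed_above T v -> al <= 0 -> al <= m - T ->
  0 < al + L%:Z -> T < al + L%:Z ->
  wsum i j m n al L v =
  Qop i j m n v + ((i == j)%:R * (m == 0)%:R * defect q n al) *: v.
Proof.
move=> kv al0 alT L0 LT; rewrite /Qop (quadE _ _ _ kv al0 alT L0 LT).
under [in RHS]eq_bigr => x _ do rewrite nordE scalerBr.
rewrite sumrB -/(wsum i j m n al L v).
rewrite (eq_bigr (fun x : 'I_L => ((i == j)%:R * (m == 0)%:R) *:
  ((q ^ (- (n * (al + x%:Z))) * step K (al + x%:Z)) *: v))); last first.
  by move=> x _; rewrite !scalerA; congr (_ *: _); ring.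
rewrite -scaler_sumr -scaler_suml window_step // scalerA.
by rewrite -[_ - _ - _]addrA -opprD -scalerDl -mulrDr subrK subrK.
Qed.

Lemma wsum_linear i j m n al L : linear (wsum i j m n al L).
Proof.
move=> c v w; rewrite scaler_sumr -big_split /=; apply: eq_bigr => x _.
by rewrite /mode !linearP /= [in RHS]scalerA mulrC -scalerA.
Qed.

Lemma QopE i j m n v T al L : killed_above T v -> al <= 0 -> al <= m - T ->
  0 < al + L%:Z -> T < al + L%:Z ->
  Qop i j m n v =
  wsum i j m n al L v - ((i == j)%:R * (m == 0)%:R * defect q n al) *: v.
Proof. by move=> kv al0 alT L0 LT; rewrite (wsumE _ _ _ kv) // addrK. Qed.

Lemma locally_nilpotent2 v w :
  exists T : int, [/\ 0 <= T, killed_above T v & killed_above T w].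
Proof.
have [T T0 kv] := locally_nilpotent v; have [T' _ kw] := locally_nilpotent w.
exists (Num.max T T'); split; first by rewrite le_max T0.
  by apply: killed_aboveW kv; rewrite le_max lexx.
by apply: killed_aboveW kw; rewrite le_max lexx orbT.
Qed.

(** The support of the sum in [quad] depends on the vector, so linearity is checked on a window
    large enough for both vectors and their combination. *)
Lemma Qop_linear i j m n : linear (Qop i j m n).
Proof.
move=> c v w; have [T [T0 kv kw]] := locally_nilpotent2 v w.
have kvw : killed_above T (c *: v + w).
  by move=> x s Ts; rewrite linearP kv // kw // scaler0 addr0.
pose B := (`|T| + `|m|)%N; pose al : int := - B%:Z; pose L := (B + B + 1)%N.
have al0 : al <= 0 by lia.
have alT : al <= m - T by lia.
have L0 : 0 < al + L%:Z by lia.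
have LT : T < al + L%:Z by lia.
rewrite !(QopE _ _ _ _ al0 alT L0 LT) // wsum_linear scalerDr scalerBr.
by rewrite opprD addrACA !scalerA [c * _]mulrC.
Qed.

Lemma nord_sym (u w : int -> V -> V) m n v : nord u w m n v = - nord w u n m v.
Proof.
rewrite /nord; case: ltgtP => _; rewrite ?opprK //.
by rewrite -scalerN opprB.
Qed.

Lemma fshiftN n : fshift q (- n) = - fshift q n.
Proof.
rewrite /fshift; have qn0 := expfz_neq0 n q0.
rewrite -invr_expz invr_eq1; case: eqP => [_|/eqP qn]; first by rewrite oppr0.
by field; rewrite subr_eq0 qn h2 qn0 mulN1r subr_eq0 eq_sym qn.
Qed.

(** Substituting s -> m - s exchanges the two factors of a normally ordered product, which changes
    its sign, and the shift is odd in n. The scalar and -n are those of bar(x^m y^n) = q^(-(m n))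
    x^m y^(-n). *)
Lemma Qop_sym i j m n v :
  Qop i j m n v =
  - (q ^ (- (m * n)) *: Qop (dual_idx j) (dual_idx i) m (- n) v).
Proof.
have [T T0 kv] := locally_nilpotent v.
pose B := (`|T| + `|m| + `|m|)%N; pose al : int := - B%:Z.
(* [al'] is the lower end of the window reflected by s -> m - s. *)
pose L := (B + B + 1)%N; pose al' := m - al - L%:Z + 1.
rewrite /Qop scalerBr opprB [RHS]addrC; congr (_ + _); last first.
  rewrite fshiftN (inj_eq (@dual_idx_inj N)) [j == i]eq_sym !mulrN scaleNr.
  rewrite scalerN scalerA; congr (- (_ *: _)).
  case: (m =P 0) => [->|_];
    by rewrite ?mul0r ?oppr0 ?expr0z ?mulr0 ?mul0r ?mulr0 ?mul1r.
rewrite dual_idxK (quadE (al := al) (L := L) _ _ _ kv); try lia.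
under eq_bigr => x _ do rewrite nord_sym scalerN.
rewrite sumrN; congr (- _).
have -> : quad q (fld (dual_idx j)) (fld i) m (- n) v =
    quad q (fld (dual_idx j)) (fld (dual_idx (dual_idx i))) m (- n) v.
  by rewrite dual_idxK.
rewrite (quadE (al := al') (L := L) _ _ _ kv); try lia.
rewrite scaler_sumr dual_idxK.
pose F t := q ^ (- (m * n)) *: (q ^ (- (- n * t)) *:
  nord (fld (dual_idx j)) (fld i) (m - t) t v).
rewrite -[RHS](window_rev F); apply: eq_bigr => x _.
by rewrite /F scalerA -expfzDr // subKr; congr (q ^ _ *: _); ring.
Qed.

(** This is [AB, C] = A{B, C} - {A, C}B for the products in a window; the scalar in [QopE] commutes
    with the fields and cancels. *)
Lemma Qop_fld i j m n k p v :
  Qop i j m n (fld k p v) =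
  fld k p (Qop i j m n v) + ((j == k)%:R * q ^ (n * p)) *: fld i (m + p) v
  - ((k == dual_idx i)%:R * q ^ (- (n * (m + p))))
    *: fld (dual_idx j) (m + p) v.
Proof.
have [T [T0 kv kw]] := locally_nilpotent2 v (fld k p v).
(* B is at least |p| and |m + p|, so the window contains the modes s = -p and s = m + p, the only
   ones at which an anticommutator survives. *)
pose B := (`|T| + `|m| + `|p|)%N; pose al : int := - B%:Z.
pose L := (B + B + 1)%N.
have al0 : al <= 0 by lia.
have alT : al <= m - T by lia.
have L0 : 0 < al + L%:Z by lia.
have LT : T < al + L%:Z by lia.
rewrite !(QopE _ _ _ _ al0 alT L0 LT) // linearB [fld k p (_ *: v)]linearZ /=.
rewrite [X in _ = X - _]addrAC [RHS]addrAC; congr (_ - _).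
rewrite linear_sum.
have modeE t : mode i j m t (fld k p v) = fld k p (mode i j m t v)
   + ((k == j)%:R * (t + p == 0)%:R) *: fld i (m - t) v
   - ((k == dual_idx i)%:R * (m - t + p == 0)%:R) *: fld (dual_idx j) t v.
  rewrite /mode [fld (dual_idx j) t (fld _ _ _)]fld_swap dual_idxK.
  rewrite linearB linearZ /=.
  rewrite [fld i _ (fld k p _)]fld_swap opprB.
  by rewrite addrA [X in X - _]addrC.
rewrite /wsum (eq_bigr _ (fun (x : 'I_L) _ => congr1 _ (modeE _))).
under eq_bigr => x _ do rewrite scalerBr scalerDr.
rewrite sumrB big_split /= -!addrA; congr (_ + (_ - _)).
- by apply: eq_bigr => x _; rewrite linearZ.
- rewrite (window_delta (F := fun t => q ^ (- (n * t)) *: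
      (((k == j)%:R * (t + p == 0)%:R) *: fld i (m - t) v))
      (t := - p)); try lia.
    rewrite addNr eqxx mulr1 scalerA opprK mulrC [k == j]eq_sym.
    by congr (_ * q ^ _ *: _); ring.
  move=> t tp; rewrite (_ : (t + p == 0) = false) ?mulr0 ?scale0r ?scaler0 //.
  lia.
- rewrite (window_delta (F := fun t => q ^ (- (n * t)) *:
      (((k == dual_idx i)%:R * (m - t + p == 0)%:R) *: fld (dual_idx j) t v))
      (t := m + p)); try lia.
    by rewrite opprD addNKr addNr eqxx mulr1 scalerA mulrC.
  move=> t tp; rewrite (_ : (m - t + p == 0) = false).
    by rewrite mulr0 scale0r scaler0.
  lia.
Qed.

(* [wsum_br] and [Qop_br] are twice the operators by which the bracket of
   [e_ij(x^m y^n)] and [e_kl(x^p y^s)] acts, without and with the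
   regularisation, which is what produces the central term. *)
Definition wsum_br i j k l m n p s al L v : V :=
  ((j == k)%:R * q ^ (n * p)) *: wsum i l (m + p) (n + s) al L v
  - ((i == l)%:R * q ^ (m * s)) *: wsum k j (m + p) (n + s) (m + al) L v.

Definition Qop_br i j k l m n p s v : V :=
  ((j == k)%:R * q ^ (n * p)) *: Qop i l (m + p) (n + s) v
  - ((i == l)%:R * q ^ (m * s)) *: Qop k j (m + p) (n + s) v
  + (m%:~R * q ^ (n * p) * (j == k)%:R * (i == l)%:R * (m + p == 0)%:R
     * (q ^ (n + s) == 1)%:R) *: v.

(** The scalars enter only when j = k, i = l and p = -m. By [defectD] they then cancel except for
    the inhomogeneous term, which is the central term. *)
Lemma wsum_brE i j k l m n p s v T al L : killed_above T v ->
  al <= - `|m| -> al <= - (`|T| + `|p| + `|m|) ->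
  `|m| + `|T| < al + L%:Z ->
  wsum_br i j k l m n p s al L v = Qop_br i j k l m n p s v.
Proof.
move=> kv al0 alT LT; rewrite /wsum_br !(wsumE _ _ _ kv); try lia.
rewrite /Qop_br !scalerDr opprD addrACA; congr (_ + _).
rewrite !scalerA -scalerBl; congr (_ *: _).
rewrite [k == j]eq_sym; case: (j == k); last by rewrite !(mulr0, mul0r) subr0.
case: (i == l); last by rewrite !(mulr0, mul0r) subr0.
case: (m + p =P 0) => [mp|_]; last by rewrite !(mulr0, mul0r) subr0.
have -> : p = - m by lia.
rewrite defectD //= !mul1r !mulr1 mulrBr !mulrA -expfzDr //.
have -> : m * s - (n + s) * m = n * - m by ring.
rewrite opprB addrC addrNK; case: eqP => [qn|]; last by rewrite !(mulr0, mul0r).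
rewrite !mulr1 mulrC; congr (_ * _).
(* Where q^(n + s) = 1, the prefactor q^(m s) equals q^(n p). *)
have -> : m * s = n * - m + (n + s) * m by ring.
by rewrite expfzDr // -[q ^ ((n + s) * m)]exprz_exp qn exp1rz mulr1.
Qed.

(** Since [Q, AB] = [Q, A]B + A[Q, B], [Qop_fld] yields four terms. Those from the second factor
    move its mode from t to m + t, hence the translated windows. The last two terms are the first
    two with i, j, n replaced as in [Qop_sym]. *)
Lemma mode_comm i j k l m n p s t v :
  q ^ (- (s * t)) *:
    (Qop i j m n (mode k l p t v) - mode k l p t (Qop i j m n v)) =
    ((j == k)%:R * q ^ (n * p)) *:
      (q ^ (- ((n + s) * t)) *: mode i l (m + p) t v)
  - ((i == l)%:R * q ^ (m * s)) *:
      (q ^ (- ((n + s) * (m + t))) *: mode k j (m + p) (m + t) v)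
  - q ^ (- (m * n)) *: (
      ((dual_idx i == k)%:R * q ^ (- n * p)) *:
        (q ^ (- ((- n + s) * t)) *: mode (dual_idx j) l (m + p) t v)
    - ((dual_idx j == l)%:R * q ^ (m * s)) *:
        (q ^ (- ((- n + s) * (m + t))) *:
           mode k (dual_idx i) (m + p) (m + t) v)).
Proof.
have mpt : m + p - (m + t) = p - t by ring.
have mpt' : m + (p - t) = m + p - t by ring.
rewrite /mode !Qop_fld !dual_idxK mpt mpt' [fld k _ (_ - _)]linearB.
rewrite [fld k _ (_ + _)]linearD ![fld k _ (_ *: _)]linearZ /=.
set z := fld k _ (fld _ t (Qop _ _ _ _ _)).
set x1 := fld i _ (fld _ t v); set x2 := fld _ _ (fld _ t v).
set x3 := fld k _ (fld i _ v); set x4 := fld k _ (fld _ _ v).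
rewrite [X in _ *: X](ACl (1*6*(4*3*(2*5)))) /= subrr add0r.
rewrite [k == _]eq_sym [dual_idx l == _]eq_sym (inj_eq (@dual_idx_inj N)).
rewrite dual_eq [in RHS]scalerBr opprB !scalerDr !scalerN !scalerA.
have scal (b : bool) (c x d y u : int) : c + x = d + y + u ->
    q ^ c * (b%:R * q ^ x) = q ^ d * (b%:R * q ^ y * q ^ u) :> K.
  move=> e; rewrite [LHS]mulrCA -expfzDr // e -(mulrA b%:R).
  by rewrite [RHS]mulrCA -!expfzDr // addrA.
have scal1 (b : bool) (c x y u : int) : c + x = y + u ->
    q ^ c * (b%:R * q ^ x) = b%:R * q ^ y * q ^ u :> K.
  by move=> e; rewrite mulrCA -mulrA -!expfzDr // e.
congr (_ *: x1 - _ *: x4 + (_ *: x3 - _ *: x2)).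
- by apply: scal1; ring.
- by apply: scal1; ring.
- by apply: scal; ring.
- by apply: scal; ring.
Qed.

(** Only the second operator is expanded, over one window valid for v and for its image under the
    first. The scalar in the expansion commutes with the first operator and drops out. *)
Lemma Qop_comm i j k l m n p s v :
  Qop i j m n (Qop k l p s v) - Qop k l p s (Qop i j m n v) =
  Qop_br i j k l m n p s v
  - q ^ (- (m * n)) *: Qop_br (dual_idx j) (dual_idx i) k l m (- n) p s v.
Proof.
have [T [T0 kv kw]] := locally_nilpotent2 v (Qop i j m n v).
pose B := (`|T| + `|m| + `|p|)%N; pose al : int := - B%:Z.
pose L := (B + B + 1)%N.
have brE i' j' n' :
    wsum_br i' j' k l m n' p s al L v = Qop_br i' j' k l m n' p s v.
  by apply: (wsum_brE _ _ _ _ _ _ kv); lia.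
rewrite -!brE.
rewrite [Qop k l p s v](QopE (al := al) (L := L) _ _ _ kv); try lia.
rewrite [Qop k l p s (Qop _ _ _ _ _)](QopE (al := al) (L := L) _ _ _ kw);
  try lia.
have QopB x y c : Qop i j m n (x - c *: y) = Qop i j m n x - c *: Qop i j m n y.
  by rewrite [x - _]addrC -(scaleNr c y) Qop_linear scaleNr addrC.
rewrite QopB opprB addrA subrK /wsum_br /wsum.
rewrite linear_sumZ; last exact: Qop_linear.
rewrite -sumrB !scaler_sumr -!sumrB scaler_sumr -sumrB; apply: eq_bigr => x _.
by rewrite -scalerBr mode_comm !addrA.
Qed.

End Fock.

(** * Linear extensions and the involution defining S *)

Lemma lext_comp (K : fieldType) (I : choiceType) (W W' : lmodType K)
    (f : {linear W -> W'}) (h : I -> W) (g : Defs.free K I) :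
  f (lext h g) = lext (fun k => f (h k)) g.
Proof.
by rewrite /lext linear_sum; apply: eq_bigr => k _; rewrite linearZ.
Qed.

(** All c(n) act by the same scalar, so an element of their span acts through the sum of its
    coefficients. *)
Lemma lext_const (K : fieldType) (I : choiceType) (W : lmodType K)
    (g : Defs.free K I) : exists c : K, forall w : W, lext (fun=> w) g = c *: w.
Proof. by eexists => w; rewrite /lext -scaler_suml. Qed.

Section Star.
Context (K : fieldType) (q : K) (q0 : q != 0) (N : nat).
Local Notation r := (1 + (N + N))%N.

Lemma GmxE (i j : 'I_r) : Gmx K N i j = (j == dual_idx i)%:R.
Proof.
elim/idx_ind: i => [|i|i]; elim/idx_ind: j => [|j|j];
  rewrite ?dual_zero ?dual_pos ?dual_neg ?eqxx ?idx_eqE /Gmx;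
  do 6?rewrite ?mxE ?split_idx /=; by rewrite 1?eq_sym.
Qed.

Lemma invmx_Gmx : invmx (Gmx K N) = Gmx K N.
Proof.
have GG : Gmx K N *m Gmx K N = 1%:M.
  apply/matrixP => i j; rewrite !mxE (bigD1 (dual_idx i)) //= big1 ?addr0.
    by rewrite !GmxE eqxx mul1r dual_idxK eq_sym.
  by move=> k ki; rewrite !GmxE (negbTE ki) mul0r.
have [Gu _] := mulmx1_unit GG.
by rewrite -[LHS]mulmx1 -GG mulmxA mulVmx // mul1mx.
Qed.

Lemma starE (X : gl q0 r) i j :
  star X i j = bar (X (dual_idx j) (dual_idx i)).
Proof.
have embE a b : map_mx (fun c : K => c%:A : qtorus q0) (Gmx K N) a b =
    (b == dual_idx a)%:R by rewrite mxE GmxE scaler_nat.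
rewrite /star invmx_Gmx; move: (map_mx _ (Gmx K N)) embE => E embE.
rewrite !mxE (bigD1 (dual_idx j)) //= big1 ?addr0 => [|k kj].
  rewrite embE dual_idxK eqxx mulr1 mxE.
  rewrite (bigD1 (dual_idx i)) //= big1 ?addr0 => [|k ki].
    by rewrite embE eqxx mul1r !mxE.
  by rewrite embE (negbTE ki) mul0r.
by rewrite embE dual_eq eq_sym (negbTE kj) mulr0.
Qed.

Lemma SsetE (X : gl q0 r) : Sset X ->
  forall i j, bar (X i j) = - X (dual_idx j) (dual_idx i).
Proof.
move=> SX i j; have := starE X (dual_idx j) (dual_idx i).
by rewrite SX !dual_idxK mxE.
Qed.

(** The involution reverses products, hence S is closed under commutators; entrywise, the summation
    index is replaced by its dual. *)
Lemma Gprime_S (X : gl q0 r) : Gprime X -> Sset X.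
Proof.
move=> [n [c [B [C [BC ->]]]]]; apply/matrixP => i j.
rewrite starE mxE !summxE linear_sum -sumrN; apply: eq_bigr => x _.
have [SB SC] := BC x.
have commE (Y Z : gl q0 r) a b :
    comm Y Z a b = \sum_k (Y a k * Z k b - Z a k * Y k b).
  by rewrite /comm !mxE -sumrB.
have scaleE (d : K) (Y : gl q0 r) a b : (d *: Y) a b = d *: Y a b.
  by rewrite mxE.
rewrite !scaleE linearZ -scalerN; congr (_ *: _).
rewrite !commE linear_sum -sumrN.
rewrite (reindex_inj (@dual_idx_inj N)) /=; apply: eq_bigr => k _.
by rewrite linearB /= !barM !SsetE // !dual_idxK !mulrNN opprB.
Qed.

End Star.

(** * The action of matrices and of the centre *)

Section Action.
Context (K : fieldType) (q : K) (q0 : q != 0).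
Context (N : nat) (V : lmodType K) (A : alpha_ops N V).
Local Notation r := (1 + (N + N))%N.
Local Notation Cq := (qtorus q0).
Local Notation glhat := (glhat q0 r).
Local Notation Qop := (Qop q A).
Local Notation Qop_br := (Qop_br q A).

Definition Qlin (i j : 'I_r) (v : V) (a : Cq) : V :=
  lext (fun u => Qop i j u.1 u.2 v) a.

HB.instance Definition _ i j v := GRing.isLinear.Build K Cq V *:%R (Qlin i j v)
  (lext_is_linear _).

Definition Qgl (v : V) (X : gl q0 r) : V := \sum_i \sum_j Qlin i j v (X i j).

Lemma Qgl_is_linear v : linear (Qgl v).
Proof.
move=> c X Y; rewrite scaler_sumr -big_split /=; apply: eq_bigr => i _.
rewrite scaler_sumr -big_split /=; apply: eq_bigr => j _.
by rewrite !mxE linearP.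
Qed.

HB.instance Definition _ v :=
  GRing.isLinear.Build K (gl q0 r) V *:%R (Qgl v) (Qgl_is_linear v).

(** An element of S contains each e_ij(a) together with its mirror, which acts by the same operator;
    the factor one half compensates for this. *)
Definition act (v : V) (X : glhat) : V :=
  2^-1 *: (Qgl v X.1.1 + lext (fun=> v) X.1.2).

Lemma act_is_linear v : linear (act v).
Proof.
move=> c X Y; rewrite /act -[(c *: X + Y).1.1]/(c *: X.1.1 + Y.1.1).
rewrite -[(c *: X + Y).1.2]/(c *: X.1.2 + Y.1.2) !linearP /=.
by rewrite addrACA scalerDr -[c *: _ + c *: _]scalerDr !scalerA mulrC.
Qed.

HB.instance Definition _ v :=
  GRing.isLinear.Build K glhat V *:%R (act v) (act_is_linear v).

Lemma actZ v c X : act v (c *: X) = c *: act v X.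
Proof. exact: linearZ. Qed.

Lemma actD v X Y : act v (X + Y) = act v X + act v Y.
Proof. exact: linearD. Qed.

Lemma actN v X : act v (- X) = - act v X.
Proof. exact: linearN. Qed.

Lemma Qgl_eij i j a v : Qgl v (eij i j a) = Qlin i j v a.
Proof.
rewrite /Qgl (bigD1 i) //= (bigD1 j) //= !big1 ?addr0 => [|k ki|k kj].
- by rewrite eijE !eqxx.
- rewrite big1 // => l _; rewrite eijE eq_sym (negbTE ki) linear0 //.
- by rewrite eijE eqxx eq_sym (negbTE kj) linear0.
Qed.

Lemma act_glin X v : act v (glin X) = 2^-1 *: Qgl v X.
Proof. by rewrite /act /= linear0 addr0. Qed.

Lemma act_cn n v : act v (cn q0 r n) = 2^-1 *: v.
Proof. by rewrite /act /= lextU linear0 add0r. Qed.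

Lemma act_cy v : act v (cy q0 r) = 0.
Proof. by rewrite /act /= !linear0 addr0 scaler0. Qed.

Lemma act_cnz t v : act v (cnz q0 r t) = 2^-1 *: ((q ^ t == 1)%:R *: v).
Proof.
rewrite /cnz; case: insubP => [n -> _|/negbTE ->].
  by rewrite act_cn scale1r.
by rewrite linear0 scale0r scaler0.
Qed.

Lemma act_br_mon i j k l m n p s v :
  act v (br_mon q0 i j k l m n p s) = 2^-1 *: Qop_br i j k l m n p s v.
Proof.
rewrite /br_mon !actD actN !actZ act_cy scaler0 addr0 act_cnz.
rewrite !act_glin !Qgl_eij /Qlin !lextU /= /Qop_br.
move: (Qop i l _ _ v) (Qop k j _ _ v) => x y.
by rewrite scalerDr scalerBr !scalerA; congr (_ *: _ - _ *: _ + _ *: _); ring.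
Qed.

End Action.

(** * Linearity and the bracket relation *)

Section Representation.
Context (K : fieldType) (h2 : 2%:R != 0 :> K) (q : K) (q0 : q != 0).
Context (N : nat) (V : lmodType K) (A : alpha_ops N V) (v0 : V).
Hypothesis hV : vacuum_module A v0.
Local Notation r := (1 + (N + N))%N.
Local Notation Cq := (qtorus q0).
Local Notation glhat := (glhat q0 r).
Local Notation Qop := (Qop q A).
Local Notation Qop_br := (Qop_br q A).
Local Notation Qlin := (Qlin A).
Local Notation Qgl := (Qgl A).
Local Notation act := (act A).

Lemma lext_linear_val (I : choiceType) (f : I -> V -> V) (g : Defs.free K I) :
  (forall k, linear (f k)) -> linear (fun v => lext (f^~ v) g).
Proof.
move=> fL c v w; rewrite -lext_Zl -lext_Dl; apply: eq_lext => k; exact: fL.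
Qed.

Lemma Qlin_linear i j (a : Cq) : linear (fun v => Qlin i j v a).
Proof.
apply: (lext_linear_val (f := fun u => Qop i j u.1 u.2)) => u.
exact: (Qop_linear h2 q0 hV).
Qed.

Lemma Qgl_linear (X : gl q0 r) : linear (fun v => Qgl v X).
Proof.
move=> c v w; rewrite scaler_sumr -big_split /=; apply: eq_bigr => i _.
rewrite scaler_sumr -big_split /=; apply: eq_bigr => j _; exact: Qlin_linear.
Qed.

Lemma act_linear (X : glhat) : linear (fun v => act v X).
Proof.
move=> c v w; rewrite /act Qgl_linear; have [d dE] := lext_const V X.1.2.
rewrite !dE [d *: (_ + _)]scalerDr addrACA [d *: (c *: v)]scalerA [d * c]mulrC.
by rewrite -scalerA -scalerDr [LHS]scalerDr !scalerA mulrC.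
Qed.

Definition Qop_br_lin (i j k l : 'I_r) v (a b : Cq) : V :=
  lext (fun u => lext (fun w => Qop_br i j k l u.1 u.2 w.1 w.2 v) b) a.

Lemma Qop_br_lin_linear_l i j k l v b : linear ((Qop_br_lin i j k l v)^~ b).
Proof. exact: lext_is_linear. Qed.

Lemma Qop_br_lin_linear_r i j k l v a : linear (Qop_br_lin i j k l v a).
Proof.
move=> c b1 b2; rewrite /Qop_br_lin -lext_Zl -lext_Dl; apply: eq_lext => u.
exact: lext_is_linear.
Qed.

Lemma act_hbr v (X Y : glhat) : act v (hbr q0 r X Y) =
  2^-1 *: \sum_i \sum_j \sum_k \sum_l
    Qop_br_lin i j k l v (X.1.1 i j) (Y.1.1 k l).
Proof.
rewrite /hbr linear_sum scaler_sumr; apply: eq_bigr => i _.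
rewrite linear_sum scaler_sumr; apply: eq_bigr => j _.
rewrite linear_sum scaler_sumr; apply: eq_bigr => k _.
rewrite linear_sum scaler_sumr; apply: eq_bigr => l _.
rewrite lext_comp /Qop_br_lin -lext_Zl; apply: eq_lext => u.
rewrite lext_comp -lext_Zl; apply: eq_lext => w; exact: act_br_mon.
Qed.

(** Both sides are bilinear in a and b, so monomials suffice; there [bar] accounts for the factor
    q^(-(m n)) and the sign of n in [Qop_comm]. *)
Lemma Qlin_comm i j k l (a b : Cq) v :
  Qlin i j (Qlin k l v b) a - Qlin k l (Qlin i j v a) b =
  Qop_br_lin i j k l v a b
  - Qop_br_lin (dual_idx j) (dual_idx i) k l v (bar a) b.
Proof.
have Qa i' j' v' : linear (Qlin i' j' v') by exact: lext_is_linear.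
move: a; apply: qt_lin_eq => [c a1 a2|c a1 a2|m n].
- by rewrite !Qa Qlin_linear scalerBr opprD addrACA.
- by rewrite bar_linear !Qop_br_lin_linear_l scalerBr opprD addrACA.
move: b; apply: qt_lin_eq => [c b1 b2|c b1 b2|p s].
- by rewrite !Qa Qlin_linear scalerBr opprD addrACA.
- by rewrite !Qop_br_lin_linear_r scalerBr opprD addrACA.
have -> : bar (mon q0 m n) = q ^ (- (m * n)) *: mon q0 m (- n).
  by rewrite bar_mon monM add0r addr0; congr (q ^ _ *: _); ring.
have -> c a b : Qop_br_lin (dual_idx j) (dual_idx i) k l v (c *: a) b =
    c *: Qop_br_lin (dual_idx j) (dual_idx i) k l v a b.
  by rewrite /Qop_br_lin linearZ.
by rewrite /Qlin /Qop_br_lin !lextU /= (Qop_comm h2 q0 hV).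
Qed.

(** For X in S, bar (X i j) is minus the mirror entry, so after reindexing the second part of
    [Qlin_comm] repeats the first. Hence the factor 2. *)
Lemma Qgl_comm (X Y : gl q0 r) v : Sset X ->
  Qgl (Qgl v Y) X - Qgl (Qgl v X) Y =
  2%:R *: \sum_i \sum_j \sum_k \sum_l Qop_br_lin i j k l v (X i j) (Y k l).
Proof.
move=> SX; have QglE w Z : Qgl w Z = \sum_x Qlin x.1 x.2 w (Z x.1 x.2).
  exact: pair_bigA.
rewrite !QglE.
rewrite (eq_bigr (fun x => \sum_y
    Qlin x.1 x.2 (Qlin y.1 y.2 v (Y y.1 y.2)) (X x.1 x.2))); last first.
  move=> x _; exact: linear_sum_fun (Qlin_linear _ _ _).
rewrite [X in _ - X](eq_bigr (fun y => \sum_x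
    Qlin y.1 y.2 (Qlin x.1 x.2 v (X x.1 x.2)) (Y y.1 y.2))); last first.
  move=> y _; exact: linear_sum_fun (Qlin_linear _ _ _).
rewrite [X in _ - X]exchange_big -sumrB /=.
under eq_bigr => x _.
  rewrite -sumrB; under eq_bigr => y _ do rewrite Qlin_comm.
  rewrite sumrB SsetE //; over.
rewrite sumrB.
pose F (x : 'I_r * 'I_r) :=
  \sum_y Qop_br_lin x.1 x.2 y.1 y.2 v (X x.1 x.2) (Y y.1 y.2).
have -> : \sum_i \sum_j \sum_k \sum_l Qop_br_lin i j k l v (X i j) (Y k l) =
    \sum_x F x.
  rewrite pair_bigA; apply: eq_bigr => x _; exact: pair_bigA.
rewrite scaler_nat mulr2n; congr (_ + _); rewrite -sumrN.
have dK : involutive (fun x : 'I_r * 'I_r => (dual_idx x.2, dual_idx x.1)).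
  by case=> i j /=; rewrite !dual_idxK.
rewrite [RHS](reindex_inj (inv_inj dK)) /=; apply: eq_bigr => x _.
rewrite /F -sumrN; apply: eq_bigr => y _ /=.
by rewrite [in LHS]/Qop_br_lin linearN opprK.
Qed.

(** Two actions give a factor 1/4 and [Qgl_comm] a factor 2, which leaves the 1/2 of [act_hbr]; the
    central parts act by scalars and cancel. *)
Lemma act_comm (X Y : glhat) v : Sset X.1.1 ->
  act v (hbr q0 r X Y) = act (act v Y) X - act (act v X) Y.
Proof.
move=> SX; rewrite act_hbr.
have [c cE] := lext_const V X.1.2; have [d dE] := lext_const V Y.1.2.
have -> : act (act v Y) X - act (act v X) Y =
    (2^-1 * 2^-1) *: (Qgl (Qgl v Y.1.1) X.1.1 - Qgl (Qgl v X.1.1) Y.1.1).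
  have QglZ a w (Z : gl q0 r) : Qgl (a *: w) Z = a *: Qgl w Z.
    (* Homogeneity is extracted from linearity at (a - 1) *: w + w. *)
    rewrite -[a in LHS](subrK 1) scalerDl scale1r Qgl_linear.
    by rewrite scalerBl scale1r subrK.
  have QglD a w w' (Z : gl q0 r) :
      Qgl (w + a *: w') Z = Qgl w Z + a *: Qgl w' Z.
    by rewrite addrC Qgl_linear addrC.
  rewrite /act !cE !dE !QglZ !QglD.
  rewrite ![_ *: (2^-1 *: _)]scalerA ![_ * 2^-1]mulrC.
  set f := Qgl v X.1.1; set g := Qgl v Y.1.1.
  rewrite -!scalerA -!scalerDr -!scalerBr; congr (_ *: (_ *: _)).
  have cancel4 (x y a b z : V) : x + a + (b + z) - (y + b + (a + z)) = x - y.
    rewrite -[x + a + _]addrA -[y + b + _]addrA [b + (a + z)]addrCA.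
    by rewrite opprD addrACA subrr addr0.
  by rewrite !scalerDr !scalerA [d * c]mulrC cancel4.
by rewrite Qgl_comm // scalerA -mulrA mulVf // mulr1.
Qed.

Lemma Qlin_mon i j m n v : Qlin i j v (mon q0 m n) = Qop i j m n v.
Proof. exact: lextU. Qed.

Lemma Qlin_anti i j m n v :
  Qlin i j v (mon q0 m n)
  - Qlin (dual_idx j) (dual_idx i) v (bar (mon q0 m n)) =
  2%:R *: Qop i j m n v.
Proof.
have -> : bar (mon q0 m n) = q ^ (- (m * n)) *: mon q0 m (- n).
  by rewrite bar_mon monM add0r addr0; congr (q ^ _ *: _); ring.
rewrite linearZ /= !Qlin_mon scaler_nat mulr2n; congr (_ + _).
by rewrite [RHS](Qop_sym h2 q0 hV).
Qed.

Lemma act_anti i j i' j' m n v : i' = dual_idx j -> j' = dual_idx i ->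
  act v (glin (eij i j (mon q0 m n) - eij i' j' (bar (mon q0 m n)))) =
  Qop i j m n v.
Proof.
move=> -> ->; rewrite act_glin linearB /= !Qgl_eij Qlin_anti.
by rewrite scalerA mulVf // scale1r.
Qed.

End Representation.

(** * The representation and its values on the generators *)

Local Open Scope complex_scope.

(** Bilinearity is stated on [Shat], which contains the generators, so that their prescribed images
    determine the action on all of [Gprime_hat]. *)
Theorem theorem2p2 (R : realType) (q : R[i]) (q0 : q != 0)
    (N : nat) (hN : (0 < N)%N)
    (V : lmodType R[i]) (A : alpha_ops N V) (v0 : V)
    (hV : vacuum_module A v0) :
  exists pi : glhat q0 (1 + (N + N)) -> V -> V,
    [/\ bilinear_on (Shat q0 N) pi,
        [/\ forall i j m n v, pi (glin (gtil q0 i j m n)) v = opG q A i j m n v,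
            forall i j m n v, pi (glin (ftil q0 i j m n)) v = opF q A i j m n v &
            forall i j m n v, pi (glin (htil q0 i j m n)) v = opH q A i j m n v],
        [/\ forall i m n v, pi (glin (etil q0 i m n)) v = opE q A i m n v,
            forall i m n v, pi (glin (estil q0 i m n)) v = opEs q A i m n v &
            forall m n v, pi (glin (e0til q0 N m n)) v = opE0 q A m n v],
        (forall (n : Lambda q) v, pi (cn q0 (1 + (N + N)) n) v = 2^-1 *: v) /\
        (forall v, pi (cy q0 (1 + (N + N))) v = 0) &
        lie_module (hbr q0 (1 + (N + N))) (Gprime_hat q0 N) pi].
Proof.
have h2 : 2%:R != 0 :> R[i] by rewrite pnatr_eq0.
exists (fun X v => act A v X); split.
- split=> [X _|c X Y v _ _]; first exact (act_linear h2 hV X).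
  exact: act_is_linear.
- split=> i j m n v.
  + rewrite /gtil (act_anti h2 q0 hV) ?dual_idxE //.
    (* Row and column indices are distinct here, so the shift vanishes. *)
    rewrite /Qop dual_neg !fldE idx_eqE.
    by rewrite !mul0r scale0r subr0.
  + rewrite /ftil (act_anti h2 q0 hV) ?dual_idxE //.
    by rewrite /Qop dual_pos !fldE idx_eqE.
  + rewrite /htil (act_anti h2 q0 hV) ?dual_idxE //.
    rewrite /Qop dual_pos !fldE idx_eqE.
    by rewrite !mul0r scale0r subr0.
- split=> [i m n v|i m n v|m n v].
  + rewrite /etil (act_anti h2 q0 hV) ?dual_idxE //.
    rewrite /Qop dual_zero !fldE idx_eqE.
    by rewrite !mul0r scale0r subr0.
  + rewrite /estil (act_anti h2 q0 hV) ?dual_idxE //.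
    rewrite /Qop dual_zero !fldE idx_eqE.
    by rewrite !mul0r scale0r subr0.
  (* [izero] is its own dual, so splitting the single entry gives the form required by
     [act_anti]. *)
  + have -> : e0til q0 N m n = eij (izero N) (izero N) (mon q0 m n) -
        eij (izero N) (izero N) (bar (mon q0 m n)).
      have subE (X Y : gl q0 _) k l : (X - Y) k l = X k l - Y k l.
        by rewrite !mxE.
      apply/matrixP => k l; rewrite subE /e0til !eijE.
      by case: ifP; rewrite ?subrr.
    rewrite (act_anti h2 q0 hV) ?dual_idxE //.
    by rewrite /Qop dual_zero !fldE eqxx mul1r.
- by split=> *; [exact: act_cn|exact: act_cy].
split; first split=> [X _|c X Y v _ _].
- exact (act_linear h2 hV X).
- exact: act_is_linear.
by move=> X Y v GX _; apply: (act_comm h2 hV); exact: Gprime_S.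
Qed.
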